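(* Any timed causal space $T=(\mathrm{aY},\mathcal H,t)$ on the circle satisfies the weak time inequality: for any events $a<b<c$ such that $b$ lies on a common light line with $a$ or with $c$, and such that $a$ and $c$ do not lie on a common light line, $$t(a,b)+t(b,c)<t(a,c).$$
   Context: **Events.** $X=S^1$. $\mathrm{aY}$ is the set of unordered pairs $(x,y)=(y,x)$ of distinct points of $X$ (called events); an event is also regarded as a two-point subset of $X$. Two events separate each other if they are disjoint as subsets and the points of one lie in different components of the complement in $X$ of the other. Two events are in the causal relation if they do not separate each other. The light line of $x\in X$ is $p_x=\{(x,x'):x'\in X\setminus\{x\}\}$. Two events are in the strong causal relation if they are in the causal relation and do not lie on a common light line. For an event $e$, let $e^+,e^-$ be the two closed arcs of $X$ with end points $e$ (labelled in either way), and $C_e^\pm=\{a\in\mathrm{aY}:a\subset e^\pm\}$. For events $e,e',e''$ we write $e\le e'\le e''$ if for a suitable labelling of the arcs of $e'$ we have $e\in C^-_{e'}$, $e''\in C^+_{e'}$; and $e<e'<e''$ if in addition $e\ne e'$ and $e''\neq e'$. **Timed causal space.** A triple $T=(\mathrm{aY},\mathcal H,t)$ where $\mathcal H$ is a collection of subsets of $\mathrm{aY}$ (timelike lines) satisfying: (h1) every event $e$ uniquely determines a timelike line $h_e\subset\mathrm{aY}$, and every timelike line is of the form $h_e$ for some event $e$; (h2) any $a\in h_e$ separates $e$; (h3) any two events on a timelike line are in the causal relation; (h4) for any $x\in X\setminus e$ there is a unique event $x_e=(x,y)\in h_e$ containing $x$; (h5) if $a\in h_e$ then $e\in h_a$;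 (h6) for any two distinct events $a,a'$ there is at most one timelike line $h_e$ with $a,a'\in h_e$; and $t$ (time) satisfies: (t1) $t(e,e')\ge0$ is defined if and only if $e,e'$ are in the causal relation; (t2) $t(e,e')=0$ iff $e,e'$ lie on a common light line; (t3) $t(e,e')=t(e',e)$ whenever defined; (t4) (a) if $e,e',e''\in h_a$ and $e\le e'\le e''$ then $t(e,e')+t(e',e'')=t(e,e'')$; (b) for every $e\in h_a$ and $s>0$ there are $e_\pm\in h_a\cap C_e^\pm$ with $t(e,e_\pm)=s$; (t5) for any $e=(x,y)$, $d=(z,u)$ in the strong causal relation, $t(z_e,u_e)=t(x_d,y_d)$; (t6) for any $e=(x,y)$ and $d=(z,u)\in h_e$, with $a=(x,z)$, $b=(x,u)$, we have $t(y_a,u_a)=t(y_b,z_b)$. *)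

(* Defs.v *)
From HB Require Import structures.
From mathcomp Require Import all_boot all_order all_algebra.
From mathcomp Require Import all_classical all_reals all_analysis.

Set Implicit Arguments.
Unset Strict Implicit.
Unset Printing Implicit Defensive.

Import Order.TTheory GRing.Theory Num.Theory.
Import numFieldNormedType.Exports.

Local Open Scope classical_set_scope.
Local Open Scope ring_scope.

(* [S1 R] carries the subspace topology of the plane, so [connected_component]
   below is taken in the circle itself. *)
Definition unit_circle (R : realType) : set (R * R) :=
  [set p | p.1 ^+ 2 + p.2 ^+ 2 = 1].

Definition S1 (R : realType) : topologicalType := set_type (@unit_circle R).

(* An unordered pair of distinct points is encoded as a two-point subset. *)
Record event (R : realType) := Event {
  points :> set (S1 R);
  pointsP : exists x y : S1 R, x <> y /\ points = [set x; y]
}.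

Definition separates (R : realType) (a b : event R) : Prop :=
  a `&` b = set0 /\
  forall x y : S1 R, points a x -> points a y -> x <> y ->
    connected_component (~` b) x <> connected_component (~` b) y.

Definition causal (R : realType) (a b : event R) : Prop := ~ separates a b.

Definition light_line (R : realType) (x : S1 R) : set (event R) :=
  [set e | exists x' : S1 R, x' <> x /\ points e = [set x; x']].

Definition on_common_light_line (R : realType) (a b : event R) : Prop :=
  exists x : S1 R, light_line x a /\ light_line x b.

Definition strongly_causal (R : realType) (a b : event R) : Prop :=
  causal a b /\ ~ on_common_light_line a b.

(* A closed arc with end points [e]: a component of the complement of [e],
   together with [e]. *)
Definition closed_arc (R : realType) (e : event R) (A : set (S1 R)) : Prop :=
  exists x : S1 R, ~ points e x /\ A = e `|` connected_component (~` e) x.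

(* [Am] and [Ap] are the arcs e^- and e^+, for one of the two labellings. *)
Definition arcs_of (R : realType) (e : event R) (Am Ap : set (S1 R)) : Prop :=
  [/\ closed_arc e Am, closed_arc e Ap & Am <> Ap].

(* For an arc [A] = e^+ or e^-, this is C_e^+ or C_e^-. *)
Definition events_in (R : realType) (A : set (S1 R)) : set (event R) :=
  [set a | points a `<=` A].

Definition event_le (R : realType) (e e' e'' : event R) : Prop :=
  exists Am Ap : set (S1 R),
    [/\ arcs_of e' Am Ap, events_in Am e & events_in Ap e''].

Definition event_lt (R : realType) (e e' e'' : event R) : Prop :=
  [/\ event_le e e' e'', e <> e' & e'' <> e'].

(* For [h e] the timelike line of [e], [event_at h e x a] says that [a] is the
   event x_e of [h e] containing [x]. *)
Definition event_at (R : realType) (h : event R -> set (event R))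
    (e : event R) (x : S1 R) (a : event R) : Prop :=
  h e a /\ points a x.

(* [time e e' = None] means that the time between [e] and [e'] is undefined. *)
Record timed_causal_space (R : realType) := TimedCausalSpace {
  timelike : set (set (event R));
  line : event R -> set (event R);
  time : event R -> event R -> option R;
  tcs_h1 : timelike = range line;
  tcs_h2 : forall e a, line e a -> separates a e;
  tcs_h3 : forall L, timelike L -> forall a b, L a -> L b -> causal a b;
  tcs_h4 : forall (e : event R) (x : S1 R), ~ points e x ->
    exists! a : event R, event_at line e x a;
  tcs_h5 : forall e a, line e a -> line a e;
  tcs_h6 : forall a a' : event R, a <> a' ->
    forall L L', timelike L -> timelike L' ->
      L a -> L a' -> L' a -> L' a' -> L = L';
  tcs_t1 : (forall e e', time e e' <-> causal e e') /\
    (forall e e' r, time e e' = Some r -> 0 <= r);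
  tcs_t2 : forall e e', time e e' = Some 0 <-> on_common_light_line e e';
  tcs_t3 : forall e e', causal e e' -> time e e' = time e' e;
  tcs_t4a : forall a e e' e'', line a e -> line a e' -> line a e'' ->
    event_le e e' e'' ->
    forall r s, time e e' = Some r -> time e' e'' = Some s ->
      time e e'' = Some (r + s);
  tcs_t4b : forall a e, line a e -> forall s : R, 0 < s ->
    forall A, closed_arc e A ->
      exists e', [/\ line a e', events_in A e' & time e e' = Some s];
  tcs_t5 : forall (e d : event R) (x y z u : S1 R),
    points e = [set x; y] -> points d = [set z; u] -> strongly_causal e d ->
    forall ze ue xd yd : event R,
      event_at line e z ze -> event_at line e u ue ->
      event_at line d x xd -> event_at line d y yd ->
      time ze ue = time xd yd;
  tcs_t6 : forall (e d a b : event R) (x y z u : S1 R),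
    points e = [set x; y] -> points d = [set z; u] -> line e d ->
    points a = [set x; z] -> points b = [set x; u] ->
    forall ya ua yb zb : event R,
      event_at line a y ya -> event_at line a u ua ->
      event_at line b y yb -> event_at line b z zb ->
      time ya ua = time yb zb
}.

(* Main.v *)
(* Put the point shared by [a] and [b] at infinity: a = {oo, z}, b = {oo, y},
   c = {u, v} with z < y < u < v on the real line. An intermediate value argument
   provides common perpendiculars p = {p1, p2} of (b, c) and q = {q1, q2} of
   (a, c), with p1 < y, q1 < z and p2, q2 in ]u, v[. Write F(m, n; k, l) for the
   time between the events through k and l on the timelike line of {m, n}: it is
   additive in (k, l) by (t4), and F(m, n; k, l) = F(k, l; m, n) by (t5). Hence
   t(a, c) = F(q; oo, v) = F(oo, v; q), and likewise t(b, c) = F(oo, v; p).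
   The lines of p and q do not cross, because they both belong to the line of c.
   If q1 < p1, then p lies inside q as seen from {oo, v}, and additivity gives
   t(b, c) < t(a, c). If p1 < q1, then q lies inside p, and
   F(z, u; p) < F(z, u; q) = F(q; z, u) = t(a, c) < t(b, c) = F(p; y, u)
   < F(p; z, u) = F(z, u; p), which is absurd. If q1 = p1, then p = q and two
   events of its timelike line share the point oo, contrary to (h4). *)

Require Import Defs.
From HB Require Import structures.
From mathcomp Require Import all_boot all_order all_algebra.
From mathcomp Require Import all_classical all_reals all_analysis.
From mathcomp Require Import ring lra.

Set Implicit Arguments.
Unset Strict Implicit.
Unset Printing Implicit Defensive.

Import Order.TTheory GRing.Theory Num.Theory.
Import numFieldNormedType.Exports.

Local Open Scope classical_set_scope.
Local Open Scope ring_scope.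

(** * Cyclic order and stereographic charts of the circle *)

Section Circle.
Context {R : realType}.
Implicit Types (s t : R) (p q r x : S1 R).

Definition abscissa (p : S1 R) : R := (set_val p).1.
Definition ordinate (p : S1 R) : R := (set_val p).2.

Lemma circle_eq p : abscissa p ^+ 2 + ordinate p ^+ 2 = 1.
Proof. exact: (set_valP p). Qed.

Lemma S1_inj p q : abscissa p = abscissa q -> ordinate p = ordinate q -> p = q.
Proof.
move=> h1 h2; apply: val_inj => /=.
by apply/pair_eqP; rewrite /pair_eq /= -/(abscissa p) -/(abscissa q)
  -/(ordinate p) -/(ordinate q) h1 h2 !eqxx.
Qed.

(** Twice the signed area of the triangle with vertices [p], [q], [r]; on the circle its sign is the
    orientation of the triple. *)
Definition det (p q r : S1 R) : R :=
  (abscissa q - abscissa p) * (ordinate r - ordinate p) -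
  (ordinate q - ordinate p) * (abscissa r - abscissa p).

(* [s = 1] is the counterclockwise and [s = -1] the clockwise cyclic order. *)
Definition cyc (s : R) (p q r : S1 R) : Prop := 0 < s * det p q r.

Lemma cyc_rot s p q r : cyc s p q r -> cyc s q r p.
Proof. by rewrite /cyc; congr (0 < s * _); rewrite /det; ring. Qed.

(** When [s ^+ 2 = 1], this is the second intersection with the circle of the line from [x] through
    [s * t * (ordinate x, - abscissa x)], a point of the diameter line perpendicular to [x]. *)
Definition chart_fun (s : R) (x : S1 R) (t : R) : R * R :=
  (abscissa x + 2 / (1 + t ^+ 2) * (- abscissa x + s * t * ordinate x),
   ordinate x + 2 / (1 + t ^+ 2) * (- ordinate x - s * t * abscissa x)).

Lemma onep_sqr_gt0 t : 0 < 1 + t ^+ 2.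
Proof. by have := sqr_ge0 t; lra. Qed.

Lemma chart_proof s x t : s ^+ 2 = 1 -> unit_circle (chart_fun s x t).
Proof.
move=> hs; rewrite /unit_circle /chart_fun /=.
have hx := circle_eq x.
have ht := onep_sqr_gt0 t.
set k := 2 / _.
have hk : k * (1 + t ^+ 2) = 2 by rewrite /k mulfVK // gt_eqF.
transitivity ((abscissa x ^+ 2 + ordinate x ^+ 2)
  * (1 - 2 * k + k * (k * (1 + s ^+ 2 * t ^+ 2)))); first by ring.
by rewrite hx hs !mul1r hk; ring.
Qed.

(* Stereographic projection from [x], as a parametrization of the complement
   of [x] that is increasing for [cyc s]. *)
Definition chart s (hs : s ^+ 2 = 1) (x : S1 R) (t : R) : S1 R :=
  SigSub (mem_set (chart_proof x t hs)).

Section Chart.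
Context (s : R) (hs : s ^+ 2 = 1) (x : S1 R).
Local Notation phi := (chart hs x).

Lemma det_chart t t' :
  det x (phi t) (phi t') = s * (t' - t) * (2 / (1 + t ^+ 2) * (2 / (1 + t' ^+ 2))).
Proof.
rewrite /det /abscissa /ordinate /= -!/(abscissa _) -!/(ordinate _).
have hx := circle_eq x.
set k := 2 / (1 + t ^+ 2); set k' := 2 / _.
transitivity ((abscissa x ^+ 2 + ordinate x ^+ 2) * (s * (t' - t) * (k * k'))).
  by rewrite /abscissa /ordinate /=; ring.
by rewrite hx mul1r.
Qed.

Lemma cyc_chart_inf t t' : cyc s x (phi t) (phi t') <-> t < t'.
Proof.
rewrite /cyc det_chart.
have h : 0 < 2 / (1 + t ^+ 2) * (2 / (1 + t' ^+ 2)).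
  by rewrite mulr_gt0 // divr_gt0 // onep_sqr_gt0.
by rewrite !mulrA -expr2 hs mul1r -!mulrA (mulrA 2) pmulr_lgt0 // subr_gt0.
Qed.

(** Up to a positive factor, [s * det] is the Vandermonde product of the three parameters, which is
    positive exactly for the rotations of an increasing triple. *)
Lemma cyc_chart t1 t2 t3 : cyc s (phi t1) (phi t2) (phi t3) <->
  [\/ t1 < t2 /\ t2 < t3, t2 < t3 /\ t3 < t1 | t3 < t1 /\ t1 < t2].
Proof.
have -> : cyc s (phi t1) (phi t2) (phi t3) <->
    0 < (t2 - t1) * (t3 - t2) * (t3 - t1).
  rewrite /cyc; set d := det _ _ _.
  (* Additivity of signed areas, with [x] as the common vertex, reduces to [det_chart]. *)
  have -> : d = det x (phi t2) (phi t3) - det x (phi t1) (phi t3)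
              + det x (phi t1) (phi t2) by rewrite /d /det; ring.
  have [h1 h2 h3] := And3 (onep_sqr_gt0 t1) (onep_sqr_gt0 t2) (onep_sqr_gt0 t3).
  rewrite !det_chart.
  set e := s * _.
  have -> : e = s ^+ 2 * ((t2 - t1) * (t3 - t2) * (t3 - t1)) *
      (4 / ((1 + t1 ^+ 2) * (1 + t2 ^+ 2) * (1 + t3 ^+ 2))).
    by rewrite /e; field; rewrite !gt_eqF.
  by rewrite hs mul1r pmulr_lgt0 // divr_gt0 // !mulr_gt0.
have pos a b c : a < b -> b < c -> 0 < (b - a) * (c - b) * (c - a) :> R.
  by move=> h1 h2; rewrite !mulr_gt0 // subr_gt0 //; apply: lt_trans h2.
split=> [h|[] [h1 h2]]; last 3 first.
- exact: pos.
- by have := pos _ _ _ h1 h2; lra.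
- by have := pos _ _ _ h1 h2; lra.
have [n12 n23 n13] : [/\ t1 <> t2, t2 <> t3 & t1 <> t3].
  by split=> e; subst; rewrite ?subrr ?mulr0 ?mul0r ltxx in h.
case: (ltgtP t1 t2) => // h12; case: (ltgtP t2 t3) => // h23;
  case: (ltgtP t1 t3) => // h13; try by [constructor 1|constructor 2|constructor 3].
- by have := pos _ _ _ h13 h23; lra.
- by have := pos _ _ _ h12 h13; lra.
- by have := pos _ _ _ h23 h12; lra.
- by have := pos _ _ _ h23 h12; lra.
Qed.

Lemma chart_inj : injective phi.
Proof.
move=> t t' e; case: (ltgtP t t') => // h; move/cyc_chart_inf: (h);
  by rewrite e => /cyc_chart_inf; rewrite ltxx.
Qed.

Lemma chart_neq t : phi t <> x.
Proof.
move=> e.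
have : cyc s x (phi t) (phi (t + 1)) by apply/cyc_chart_inf; lra.
by rewrite e /cyc /det !subrr !mul0r subrr mulr0 ltxx.
Qed.

Lemma chart_onto p : p <> x -> exists t, p = phi t.
Proof.
move=> hpx.
have [hx hp] := conj (circle_eq x) (circle_eq p).
(* [d] and the later [c] are the cosine and the sine of the angle from [x] to [p]. *)
set d := abscissa p * abscissa x + ordinate p * ordinate x.
have hd : d < 1.
  have h1 := sqr_ge0 (abscissa p - abscissa x).
  have h2 := sqr_ge0 (ordinate p - ordinate x).
  have e : (abscissa p - abscissa x) ^+ 2 + (ordinate p - ordinate x) ^+ 2
     = 2 * (1 - d) by rewrite /d !sqrrB; lra.
  rewrite ltNge; apply/negP => hd; apply: hpx.
  have e1 : (abscissa p - abscissa x) ^+ 2 = 0 by lra.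
  have e2 : (ordinate p - ordinate x) ^+ 2 = 0 by lra.
  move/eqP: e1; rewrite sqrf_eq0 subr_eq0 => /eqP e1.
  move/eqP: e2; rewrite sqrf_eq0 subr_eq0 => /eqP e2.
  exact: S1_inj.
set c := abscissa x * ordinate p - ordinate x * abscissa p.
have hcd : c ^+ 2 + d ^+ 2 = 1.
  transitivity ((abscissa x ^+ 2 + ordinate x ^+ 2)
    * (abscissa p ^+ 2 + ordinate p ^+ 2)); first by rewrite /c /d; ring.
  by rewrite hx hp mul1r.
have hd0 : 1 - d != 0 by rewrite gt_eqF // subr_gt0.
(* This is [- s] times the cotangent of half the angle, chosen so that [2 / (1 + t ^+ 2)] becomes
   [1 - d]. *)
set t := - s * c / (1 - d).
have hk : 2 / (1 + t ^+ 2) = 1 - d.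
  have -> : t ^+ 2 = s ^+ 2 * c ^+ 2 / (1 - d) ^+ 2 by rewrite /t; field.
  have -> : c ^+ 2 = (1 - d) * (1 + d) by rewrite -[c ^+ 2](addrK (d ^+ 2)) hcd; ring.
  rewrite hs; field; rewrite hd0 /=.
  by apply/eqP; have := hd; nra.
have hst : s * t * (1 - d) = - c.
  by rewrite /t mulrA (mulrC s) -mulrA;
    transitivity (- (s ^+ 2 * c)); [field|rewrite hs mul1r].
exists t; apply: S1_inj; rewrite /abscissa /ordinate /=
  -!/(abscissa _) -!/(ordinate _) hk.
- transitivity (abscissa x - abscissa x * (1 - d) + s * t * (1 - d) * ordinate x);
    last by ring.
  rewrite hst; transitivity ((abscissa x ^+ 2 + ordinate x ^+ 2) * abscissa p);
    first by rewrite hx mul1r.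
  by rewrite /c /d; ring.
- transitivity (ordinate x - ordinate x * (1 - d) - s * t * (1 - d) * abscissa x);
    last by ring.
  rewrite hst; transitivity ((abscissa x ^+ 2 + ordinate x ^+ 2) * ordinate p);
    first by rewrite hx mul1r.
  by rewrite /c /d; ring.
Qed.

Lemma chart_continuous : continuous phi.
Proof.
apply: continuous_comp_initial => t.
have hk : {for t, continuous (fun t : R => 2 / (1 + t ^+ 2))}.
  move=> /=; apply: cvgM; first exact: cvg_cst.
  apply: cvgV; first by rewrite gt_eqF // onep_sqr_gt0.
  by apply: cvgD; [exact: cvg_cst|exact: exprn_continuous].
have hl c : {for t, continuous (fun t : R => s * t * c)}.
  by move=> /=; apply: cvgM; [apply: cvgM; [exact: cvg_cst|exact: cvg_id]|exact: cvg_cst].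
have h1 : (chart_fun s x t').1 @[t' --> t] --> (chart_fun s x t).1.
  apply: cvgD; first exact: cvg_cst.
  by apply: cvgM; [exact: hk|apply: cvgD; [exact: cvg_cst|exact: hl]].
have h2 : (chart_fun s x t').2 @[t' --> t] --> (chart_fun s x t).2.
  apply: cvgD; first exact: cvg_cst.
  by apply: cvgM; [exact: hk|apply: cvgB; [exact: cvg_cst|exact: hl]].
exact: (cvg_pair h1 h2).
Qed.

End Chart.

Lemma det_continuous p q : continuous (det p q).
Proof.
have h1 : continuous (@set_val (R * R)%type (@unit_circle R)) by exact: initial_continuous.
have hX : continuous abscissa.
  by move=> r; apply: continuous_comp; [exact: h1|exact: cvg_fst].
have hY : continuous ordinate.
  by move=> r; apply: continuous_comp; [exact: h1|exact: cvg_snd].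
have hB (f : S1 R -> R) (c : R) : continuous f -> continuous (fun r : S1 R => f r - c : R).
  move=> hf r; have h := hf r; exact: (cvgB h (cvg_cst _)).
have hM (f : S1 R -> R) (c : R) : continuous f -> continuous (fun r : S1 R => c * f r : R).
  move=> hf r; have h := hf r; exact: (cvgM (cvg_cst _) h).
move=> r; exact: (cvgB (hM _ _ (hB _ _ hY) r) (hM _ _ (hB _ _ hX) r)).
Qed.

End Circle.

(** Turns a cyclic order of points of one chart, possibly with its base point among them, into
    inequalities between parameters for [lra]. *)
Ltac cyc_chart_solve :=
  lazymatch goal with
  | |- cyc _ (chart _ _ _) (chart _ _ _) (chart _ _ _) =>
      apply/cyc_chart;
      first [ constructor 1; split; lra
            | constructor 2; split; lra
            | constructor 3; split; lra ]
  | |- cyc _ _ (chart _ _ _) (chart _ _ _) => apply/cyc_chart_inf; lra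
  | |- cyc _ (chart _ _ _) (chart _ _ _) _ => apply/cyc_rot/cyc_chart_inf; lra
  | |- cyc _ (chart _ _ _) _ (chart _ _ _) =>
      apply/cyc_rot/cyc_rot/cyc_chart_inf; lra
  end.

(** * Separation in terms of the cyclic order *)

Section CyclicOrder.
Context {R : realType} (s : R) (hs : s ^+ 2 = 1).
Implicit Types (p q r x k l m n : S1 R) (a b e : event R).

Lemma cyc_neq p q r : cyc s p q r -> [/\ p <> q, q <> r & p <> r].
Proof.
by move=> h; split=> e; move: h; rewrite /cyc e /det; set d := (X in s * X);
  (have -> : d = 0 by rewrite /d; ring); rewrite mulr0 ltxx.
Qed.

Lemma cyc_asym p q r : cyc s p q r -> ~ cyc s p r q.
Proof.
rewrite /cyc; have -> : det p r q = - det p q r by rewrite /det; ring.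
by move=> h1 h2; lra.
Qed.

Lemma cyc_total p q r : p <> q -> q <> r -> p <> r -> cyc s p q r \/ cyc s p r q.
Proof.
move=> /nesym/(chart_onto hs)[b ->] qr /nesym/(chart_onto hs)[c e]; subst.
rewrite !cyc_chart_inf.
by case: (ltgtP b c) => [||e]; [left|right|subst].
Qed.

Lemma cyc_trans m k l n : cyc s m k l -> cyc s m l n -> cyc s m k n.
Proof.
move=> hkl hln; have [/nesym mk _ /nesym ml] := cyc_neq hkl.
have [_ _ /nesym nm] := cyc_neq hln.
have [K eK] := chart_onto hs mk; have [L eL] := chart_onto hs ml.
have [N eN] := chart_onto hs nm; subst.
move/cyc_chart_inf: hkl => hKL; move/cyc_chart_inf: hln => hLN.
cyc_chart_solve.
Qed.

(** In the chart at [m], the segment between the parameters of [k] and [l] stays below that of [n];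
    its image is connected and avoids [m] and [n]. *)
Lemma component_same_arc m n k l : cyc s m k n -> cyc s m l n ->
  connected_component (~` [set m; n]) k l.
Proof.
move=> hk hl; have [/nesym mk _ /nesym mn] := cyc_neq hk.
have [/nesym ml _ _] := cyc_neq hl.
have [tn en] := chart_onto hs mn; have [tk ek] := chart_onto hs mk.
have [tl el] := chart_onto hs ml; subst.
move/cyc_chart_inf: hk => hk; move/cyc_chart_inf: hl => hl.
apply: (@connected_component_max _ _ (chart hs m @` `[Order.min tk tl, Order.max tk tl])).
- by exists tk => //=; rewrite in_itv /= ge_min le_max lexx.
- move=> _ /= [t ht <-] [/(@chart_neq _ _ _ _ _)//|/(@chart_inj _ _ _ _) e].
  move: ht; rewrite e in_itv /= => /andP[_].
  by rewrite leNgt gt_max hk hl.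
- apply: connected_continuous_connected; first exact: segment_connected.
  exact/continuous_subspaceT/chart_continuous.
- by exists tl => //=; rewrite in_itv /= ge_min le_max lexx !orbT.
Qed.

(** The continuous function [det m n] has opposite signs at [k] and [l], so it would vanish
    somewhere on a component containing both; but on the circle it vanishes only at [m] and [n]. *)
Lemma component_opposite_arcs m n k l : cyc s m k n -> cyc s n l m ->
  ~ connected_component (~` [set m; n]) k l.
Proof.
move=> hk hl hC; set C := connected_component _ _ in hC.
have mn : m <> n by case: (cyc_neq hk).
have Ck : C k.
  apply: connected_component_refl; have [? ? ?] := cyc_neq hk.
  by case=> e; congruence.
have /connected_intervalP hI : connected (det m n @` C).
  apply: connected_continuous_connected; first exact: component_connected.
  exact/continuous_subspaceT/det_continuous.
have [w Cw w0] : (det m n @` C) 0.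
  have hk' : 0 < s * - det m n k by have -> : - det m n k = det m k n by rewrite /det; ring.
  have hl' : 0 < s * det m n l by have -> : det m n l = det n l m by rewrite /det; ring.
  have s0 : s != 0.
    by apply: contraPneq hs => ->; rewrite expr0n => /esym/eqP; rewrite oner_eq0.
  case: (ltgtP s 0) => [sn|sp|/eqP]; last by rewrite (negbTE s0).
    apply: (hI (det m n l) (det m n k)); [by exists l|by exists k|].
    move: hk' hl'; rewrite !nmulr_rgt0 // => hk' hl'; apply/andP; split; lra.
  apply: (hI (det m n k) (det m n l)); [by exists k|by exists l|].
  move: hk' hl'; rewrite !pmulr_rgt0 // => hk' hl'; apply/andP; split; lra.
have := connected_component_sub Cw; apply; apply: contrapT => hw.
have [wm wn] : m <> w /\ n <> w by split=> e; apply: hw; [left|right].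
case: (cyc_total mn wn wm); rewrite /cyc ?w0 ?mulr0 ?ltxx //.
have -> : det m w n = - det m n w by rewrite /det; ring.
by rewrite w0 oppr0 mulr0 ltxx.
Qed.

Definition crossing k l m n : Prop :=
  (cyc s m k n /\ cyc s n l m) \/ (cyc s m l n /\ cyc s n k m).

Lemma event_eq a b : points a = points b -> a = b.
Proof.
by case: a b => [A pA] [B pB] /= e; subst; congr Event; apply: Prop_irrelevance.
Qed.

Lemma event_neq a k l : points a = [set k; l] -> k <> l.
Proof.
move=> e kl; subst; have [x [y [xy e']]] := pointsP a.
move: e'; rewrite e setUid => e'.
have hx : [set l] x by rewrite e'; left.
have hy : [set l] y by rewrite e'; right.
by apply: xy; rewrite hx hy.
Qed.

Lemma event_exists k l : k <> l -> exists e, points e = [set k; l].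
Proof.
move=> kl; have h : exists x y, x <> y /\ [set k; l] = [set x; y] by exists k, l.
by exists (Event h).
Qed.

Lemma event_other a k : points a k -> exists l, points a = [set k; l].
Proof.
have [x [y [_ ->]]] := pointsP a; case=> ->; first by exists y.
by exists x; rewrite setUC.
Qed.

Lemma separatesP a b k l m n : points a = [set k; l] -> points b = [set m; n] ->
  separates a b <-> crossing k l m n.
Proof.
move=> ea eb; have kl := event_neq ea; have mn := event_neq eb.
rewrite /separates ea eb; split=> [[dis hsep]|h].
  have nb x : [set k; l] x -> m <> x /\ x <> n.
    move=> hx; split=> e; have : ([set k; l] `&` [set m; n]) x.
    - by split=> //; left.
    - by rewrite dis.
    - by split=> //; right.
    - by rewrite dis.
  have [mk kn] := nb k (or_introl erefl); have [ml ln] := nb l (or_intror erefl).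
  have hne := hsep k l (or_introl erefl) (or_intror erefl) kl.
  case: (cyc_total mk kn mn) => hk; case: (cyc_total ml ln mn) => hl.
  - by case: hne; apply/same_connected_component/component_same_arc.
  - by left; split=> //; apply: cyc_rot.
  - by right; split=> //; apply: cyc_rot.
  - case: hne; apply/same_connected_component; rewrite setUC.
    by apply: component_same_arc; apply: cyc_rot.
have hne : ~ connected_component (~` [set m; n]) k l.
  case: h => -[h1 h2]; first exact: component_opposite_arcs.
  by move=> /connected_component_sym; apply: component_opposite_arcs.
have [[mk kn] [ml ln]] : (m <> k /\ k <> n) /\ (m <> l /\ l <> n).
  by case: h => -[/cyc_neq[? ? ?] /cyc_neq[? ? ?]]; split; split; congruence.
split.
  by apply/seteqP; split=> // x [[|] -> [|]] e; congruence.
have nkl x y : x = k -> y = l ->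
    connected_component (~` [set m; n]) x <> connected_component (~` [set m; n]) y.
  move=> -> -> e; apply: hne; rewrite e; apply: connected_component_refl.
  by case=> e'; congruence.
by move=> x y [|] -> [|] -> // _; [exact: nkl|apply/nesym/nkl].
Qed.

End CyclicOrder.

(** * Timelike lines and their time *)

Lemma set2_inj {U : Type} (k l l' : U) : l <> k -> [set k; l] = [set k; l'] -> l = l'.
Proof.
move=> lk e; have : [set k; l'] l by rewrite -e; right.
by case.
Qed.

Section TimedCausalSpace.
Context {R : realType} (T : timed_causal_space R).
Implicit Types (k l m n r x : S1 R) (a b e : event R).

(** In the hyperbolic model, where an event is a geodesic given by its ideal end points, this is
    orthogonality of two geodesics. The arguments are end points rather than events so that they can
    be placed in charts. *)
Definition perp m n k l : Prop :=
  exists e a, [/\ points e = [set m; n], points a = [set k; l] & line T e a].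

Lemma perp_swapl m n k l : perp m n k l -> perp n m k l.
Proof.
by move=> [e [a [he ha hl]]]; exists e, a; split=> //; rewrite he setUC.
Qed.

Lemma perp_swapr m n k l : perp m n k l -> perp m n l k.
Proof.
by move=> [e [a [he ha hl]]]; exists e, a; split=> //; rewrite ha setUC.
Qed.

Lemma perp_sym m n k l : perp m n k l -> perp k l m n.
Proof. by move=> [e [a [he ha hl]]]; exists a, e; split=> //; apply: tcs_h5. Qed.

Lemma line_disjoint e a k : line T e a -> points a k -> ~ points e k.
Proof.
move=> /tcs_h2[dis _] ak ek; have : (points a `&` points e) k by [].
by rewrite dis.
Qed.

Lemma line_eq e a b k : line T e a -> line T e b -> points a k -> points b k -> a = b.
Proof.
move=> ha hb ak bk; have [c [_ hc]] := tcs_h4 T (line_disjoint ha ak).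
by rewrite -(hc a) // -(hc b).
Qed.

Lemma line_point e m n k : points e = [set m; n] -> k <> m -> k <> n ->
  exists2 a, line T e a & points a k.
Proof.
move=> he km kn; have : ~ points e k by rewrite he => -[|].
by move=> /(tcs_h4 T)[a [[? ?] _]]; exists a.
Qed.

(** Uniqueness in (h4). Together with [perp_ex] it makes [{m, n}] define an involution of the
    remaining points, the analogue of the reflection in a geodesic; the image of a point is called
    its partner below. *)
Lemma perp_uniq m n k l l' : perp m n k l -> perp m n k l' -> l = l'.
Proof.
move=> [e [a [he ha hl]]] [e' [a' [he' ha' hl']]].
have ee : e = e' by apply: event_eq; rewrite he he'.
subst e'; have aa : a = a'.
  by apply: (line_eq hl hl' (k := k)); rewrite ?ha ?ha'; left.
apply: (set2_inj (k := k)); first exact/nesym/(event_neq ha).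
by rewrite -ha -ha' aa.
Qed.

Lemma perp_ex m n k : m <> n -> k <> m -> k <> n -> exists l, perp m n k l.
Proof.
move=> /event_exists[e he] km kn; have [a hl ak] := line_point he km kn.
by have [l ha] := event_other ak; exists l, e, a.
Qed.

Lemma line_causal e a b : line T e a -> line T e b -> causal a b.
Proof.
by move=> ha hb; apply: (tcs_h3 (t := T) _ ha hb); rewrite tcs_h1; exists e.
Qed.

(* F(m, n; k, l) in the notation of the header; [0] when [m = n] or when [k] or
   [l] is in {m, n}. *)
Definition line_time m n k l : R :=
  xget 0 [set r | exists e a b,
    [/\ points e = [set m; n], event_at (line T) e k a, event_at (line T) e l b
      & time T a b = Some r]].

(** The choice in [line_time] has a single candidate: [e] is determined by its end points, then [a]
    and [b] by (h4). A value exists by (h3) and (t1). *)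
Lemma timeE m n k l e a b : points e = [set m; n] ->
  line T e a -> line T e b -> points a k -> points b l ->
  time T a b = Some (line_time m n k l).
Proof.
move=> he ha hb ak bl.
have := (tcs_t1 T).1 a b; case E: (time T a b) => [r|]; last first.
  by move=> [_ h]; have := h (line_causal ha hb).
move=> _; congr Some; symmetry; apply: xget_subset1; first by exists e, a, b.
have uniq (r' : R) : (exists e a b, [/\ points e = [set m; n],
    event_at (line T) e k a, event_at (line T) e l b & time T a b = Some r']) -> r' = r.
  move=> [e' [a' [b' [he' [ha' ak'] [hb' bl'] E']]]].
  have ee : e = e' by apply: event_eq; rewrite he he'.
  subst e'; move: E'; rewrite -(line_eq ha ha' ak ak') -(line_eq hb hb' bl bl') E.
  by case.
by move=> r1 r2 /uniq -> /uniq ->.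
Qed.

Lemma time_perp m n k k' l l' a b : perp m n k k' -> perp m n l l' ->
  points a = [set k; k'] -> points b = [set l; l'] ->
  time T a b = Some (line_time m n k l).
Proof.
move=> [e [a' [he ha hl]]] [e' [b' [he' hb hl']]] ea eb.
have ? : e = e' by apply: event_eq; rewrite he he'.
have ? : a = a' by apply: event_eq; rewrite ea ha.
have ? : b = b' by apply: event_eq; rewrite eb hb.
by subst; apply: (timeE he hl hl'); rewrite ?ea ?eb; left.
Qed.

(** Either end point of an event on the line may serve to name it. *)
Lemma line_time_perp m n k k' l l' : perp m n k k' -> perp m n l l' ->
  line_time m n k l = line_time m n k' l'.
Proof.
move=> pk pl.
have [a ha] : exists a, points a = [set k; k'] by case: pk => _ [a [_ ? _]]; exists a.
have [b hb] : exists b, points b = [set l; l'] by case: pl => _ [b [_ ? _]]; exists b.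
have := time_perp (perp_swapr pk) (perp_swapr pl).
rewrite setUC => /(_ a b ha); rewrite setUC => /(_ hb).
by rewrite (time_perp pk pl ha hb) => -[].
Qed.

Lemma line_time_swapl m n k l : line_time m n k l = line_time n m k l.
Proof. by rewrite /line_time (setUC [set m]). Qed.

Lemma line_time_swapr m n k l : line_time m n k l = line_time m n l k.
Proof.
congr (xget 0 _); apply/seteqP; split=> r /= [e [a [b [he [ha ak] [hb bl] hr]]]];
  by exists e, b, a; split=> //; rewrite tcs_t3 //; apply: line_causal hb ha.
Qed.

(** * Order properties of perpendicular pairs and of the time along a line *)

Section Order.
Context (s : R) (hs : s ^+ 2 = 1).
Local Notation cyc := (cyc s).

Lemma perp_arc m n k l : cyc m k n -> perp m n k l -> cyc n l m.
Proof.
move=> hk [e [a [he ha /(tcs_h2)/(separatesP hs ha he)[[_ //]|[_ h]]]]].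
by have /cyc_rot/cyc_rot := h; move/(cyc_asym hk).
Qed.

Lemma perp_noncrossing m n k l k' l' : perp m n k l -> perp m n k' l' ->
  ~ crossing s k l k' l'.
Proof.
move=> [e [a [he ha hl]]] [e' [a' [he' ha' hl']]].
have ? : e = e' by apply: event_eq; rewrite he he'.
subst e'; move=> /(separatesP hs ha ha'); exact: line_causal hl hl'.
Qed.

(** Passing to partners reverses the order: by (h2) the partners lie on the other arc, they are
    distinct by [perp_uniq], and in the wrong order the two events would cross, contrary to (h3). *)
Lemma perp_mono m n k k' l l' : cyc m k k' -> cyc m k' n ->
  perp m n k l -> perp m n k' l' -> cyc n l' l.
Proof.
move=> hkk hkn pk pk'.
have [/nesym mk _ /nesym mk'] := cyc_neq hkk.
have [_ _ /nesym mn] := cyc_neq hkn.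
have [K eK] := chart_onto hs mk; have [K' eK'] := chart_onto hs mk'.
have [N eN] := chart_onto hs mn; subst.
move/cyc_chart_inf: (hkk) => hKK; move/cyc_chart_inf: (hkn) => hKN.
have hl : cyc (chart hs m N) l m by apply: perp_arc pk; cyc_chart_solve.
have hl' := perp_arc hkn pk'.
have [_ lm _] := cyc_neq hl; have [_ lm' _] := cyc_neq hl'.
have [L eL] := chart_onto hs lm; have [L' eL'] := chart_onto hs lm'; subst.
move/cyc_rot/cyc_rot/cyc_chart_inf: hl => hL.
move/cyc_rot/cyc_rot/cyc_chart_inf: hl' => hL'.
case: (ltgtP L L') => hLL; first last.
- subst L'; have e := perp_uniq (perp_swapr pk) (perp_swapr pk').
  by have [] := cyc_neq hkk; rewrite e.
- by cyc_chart_solve.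
- case: (perp_noncrossing pk pk'); right; split; cyc_chart_solve.
Qed.

(** This is (t5) for the events [{m, n}] and [{k, l}]: the cyclic order m, k, l, n keeps them
    disjoint and uncrossed, hence strongly causal. *)
Lemma line_time_dual m n k l : cyc m k l -> cyc m l n ->
  line_time m n k l = line_time k l m n.
Proof.
move=> hkl hln.
have hkn := cyc_trans hs hkl hln.
have [/nesym km kl /nesym lm] := cyc_neq hkl; have [_ ln mn] := cyc_neq hln.
have [_ kn _] := cyc_neq hkn.
have hc : ~ crossing s m n k l.
  case=> -[h1 h2]; first exact: cyc_asym (cyc_rot hkl) h1.
  apply: cyc_asym h1.
  have hlnm := cyc_rot hln; have hlmk := cyc_rot (cyc_rot hkl).
  exact/cyc_rot/cyc_rot/(cyc_trans hs hlnm hlmk).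
have [e he] := event_exists mn; have [d hd] := event_exists kl.
have [ke hke kke] := line_point he km kn.
have [le hle lle] := line_point he lm ln.
have [md hmd mmd] := line_point hd (nesym km) (nesym lm).
have [nd hnd nnd] := line_point hd (nesym kn) (nesym ln).
have hsc : strongly_causal e d.
  split; first by move=> /(separatesP hs he hd).
  move=> [x [[x1 [_ e1]] [x2 [_ e2]]]].
  have : points e x by rewrite e1; left.
  have : points d x by rewrite e2; left.
  by rewrite he hd => -[] -> [] //; apply/nesym.
have := tcs_t5 (t := T) he hd hsc (conj hke kke) (conj hle lle) (conj hmd mmd) (conj hnd nnd).
by rewrite (timeE he hke hle kke lle) (timeE hd hmd hnd mmd nnd) => -[].
Qed.

(** If the time were zero, (t2) would give the two events a common point and (h4) would make them
    equal to [{k, l}]; but (h2) forbids this, as [k] and [l] are on the same arc of [{m, n}]. *)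
Lemma line_time_gt0 m n k l : cyc m k l -> cyc m l n -> 0 < line_time m n k l.
Proof.
move=> hkl hln.
have [/nesym mk kl /nesym ml] := cyc_neq hkl; have [_ ln /nesym nm] := cyc_neq hln.
have hkn := cyc_trans hs hkl hln.
have [_ kn _] := cyc_neq hkn.
have [e he] := event_exists (nesym nm).
have [a ha ak] := line_point he mk kn.
have [b hb bl] := line_point he ml ln.
have E := timeE he ha hb ak bl.
rewrite lt0r; apply/andP; split; last exact: (tcs_t1 T).2 E.
apply/eqP => E0; move: E; rewrite E0.
move=> /tcs_t2[x [[x1 [_ e1]] [x2 [_ e2]]]].
have ax : points a x by rewrite e1; left.
have bx : points b x by rewrite e2; left.
have ab := line_eq ha hb ax bx; subst b.
have ea : points a = [set k; l].
  have [l' el'] := event_other ak; rewrite el'; congr [set _; _].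
  by move: bl; rewrite el' => -[/nesym|->].
have pkl : perp m n k l by exists e, a.
by have /cyc_rot/cyc_rot/(cyc_asym hln) := perp_arc hkn pkl.
Qed.

(** The additivity (t4)(a); what has to be shown is that the three events are ordered in the sense
    of [event_le]. *)
Lemma line_time_add m n k l r : cyc m k l -> cyc m l r -> cyc m r n ->
  line_time m n k r = line_time m n k l + line_time m n l r.
Proof.
move=> hkl hlr hrn.
have [/nesym mk kl /nesym ml] := cyc_neq hkl; have [_ lr /nesym mr] := cyc_neq hlr.
have [_ rn /nesym nm] := cyc_neq hrn.
have [K eK] := chart_onto hs mk; have [L eL] := chart_onto hs ml.
have [P eP] := chart_onto hs mr; have [N eN] := chart_onto hs nm.
have [hKL hLP hPN] : [/\ K < L, L < P & P < N].
  by subst; split; apply/(cyc_chart_inf hs m).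
have hln := cyc_trans hs hlr hrn.
have [_ ln _] := cyc_neq hln; have [_ kn _] := cyc_neq (cyc_trans hs hkl hln).
have [k' pk] := perp_ex (nesym nm) mk kn.
have [l' pl] := perp_ex (nesym nm) ml ln.
have [r' pr] := perp_ex (nesym nm) mr rn.
have hl' : cyc n l' k' by apply: perp_mono pk pl => //; subst; cyc_chart_solve.
have hr' : cyc n r' l' by apply: perp_mono pl pr.
have hk' : cyc n k' m by apply: perp_arc pk; subst; cyc_chart_solve.
have hl'm : cyc n l' m by apply: perp_arc pl; subst; cyc_chart_solve.
have hr'm : cyc n r' m by apply: perp_arc pr; subst; cyc_chart_solve.
have [_ km' _] := cyc_neq hk'; have [_ lm' _] := cyc_neq hl'm.
have [_ rm' _] := cyc_neq hr'm.
have [K' eK'] := chart_onto hs km'; have [L' eL'] := chart_onto hs lm'.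
have [P' eP'] := chart_onto hs rm'; subst.
move/cyc_rot/cyc_rot/cyc_chart_inf: hk' => hK'.
move/cyc_rot/cyc_rot/cyc_chart_inf: hl'm => hL'm.
move/cyc_rot/cyc_rot/cyc_chart_inf: hr'm => hP'm.
have {hl'} hL' : L' < K' by move: hl' => /cyc_chart[] [? ?]; lra.
have {hr'} hP' : P' < L' by move: hr' => /cyc_chart[] [? ?]; lra.
have [e [a [he ha hea]]] := pk; have [e1 [b [he1 hb heb]]] := pl.
have [e2 [c [he2 hc hec]]] := pr.
have ? : e1 = e by apply: event_eq; rewrite he he1.
have ? : e2 = e by apply: event_eq; rewrite he he2.
subst e1 e2.
(* In the chart at [m] the parameters satisfy K < L < P < N < P' < L' < K'. So [a] lies on the arc
   of [b] through [m], and [c] on the arc through [phi N]. *)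
have hle : event_le a b c.
  exists (b `|` connected_component (~` b) m),
    (b `|` connected_component (~` b) (chart hs m N)).
  have nb x : [set m; chart hs m N] x -> ~ points b x.
    by move=> ex; apply: (line_disjoint (tcs_h5 heb)); rewrite he.
  have bm := nb _ (or_introl erefl); have bn := nb _ (or_intror erefl).
  split.
  - split; [by exists m|by exists (chart hs m N)|move=> eA].
    have : (b `|` connected_component (~` b) (chart hs m N)) (chart hs m N).
      by right; apply: connected_component_refl.
    rewrite -eA => -[//|].
    rewrite hb => /connected_component_sym.
    by apply: (component_opposite_arcs hs); cyc_chart_solve.
  - rewrite /events_in /= ha hb (setUC [set chart hs m L]) => x xa; right.
    by move: xa => -[] ->; apply: (component_same_arc hs); cyc_chart_solve.
  - rewrite /events_in /= hc hb => x xa; right.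
    by move: xa => -[] ->; apply: (component_same_arc hs); cyc_chart_solve.
have ak : points a (chart hs m K) by rewrite ha; left.
have bl : points b (chart hs m L) by rewrite hb; left.
have cr : points c (chart hs m P) by rewrite hc; left.
have := tcs_t4a hea heb hec hle (timeE he hea heb ak bl) (timeE he heb hec bl cr).
by rewrite (timeE he hea hec ak cr) => -[].
Qed.

End Order.
End TimedCausalSpace.

(** * Common perpendiculars and the inequality *)

(** The meeting point is the supremum of the set where [g < f]. Surjectivity of [f] stands in for
    continuity: it supplies parameters on either side of the supremum with prescribed values of [f],
    and monotonicity of [g] controls the comparison there. *)
Lemma decreasing_meet (R : realType) (f g : R -> R) (y u v : R) :
  (forall t t', t < t' -> t' < y -> f t' < f t) ->
  (forall t t', t < t' -> t' < y -> g t' < g t) ->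
  (forall r, y < r -> exists2 t, t < y & f t = r) ->
  y < u -> (forall t, t < y -> u < g t /\ g t < v) ->
  exists2 t, t < y & f t = g t.
Proof.
move=> fdec gdec fsurj yu hg.
have fle t t' : t <= t' -> t' < y -> f t' <= f t.
  by rewrite le_eqVlt => /predU1P[->//|tt ty]; exact/ltW/fdec.
have gle t t' : t <= t' -> t' < y -> g t' <= g t.
  by rewrite le_eqVlt => /predU1P[->//|tt ty]; exact/ltW/gdec.
have [t2 t2y ft2] := fsurj u yu.
have [ug2 g2v] := hg _ t2y.
have [t1 t1y ft1] := fsurj v (lt_trans yu (lt_trans ug2 g2v)).
pose S : set R := [set t | t < y /\ g t < f t].
have S1 : S t1 by split=> //; rewrite ft1; case: (hg _ t1y).
have S2 : ubound S t2.
  move=> t [ty gf]; rewrite leNgt; apply/negP => tt.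
  by have := fdec _ _ tt ty; have := hg _ ty; rewrite ft2; lra.
have supub : ubound S (sup S) by apply: sup_ubound; exists t2.
have supy : sup S < y by apply: le_lt_trans t2y; apply: ge_sup => //; exists t1.
have [ug gv] := hg _ supy.
exists (sup S) => //; apply/eqP; rewrite eq_le !leNgt; apply/andP; split; apply/negP => h.
- have [t ty ft] := fsurj ((f (sup S) + g (sup S)) / 2) ltac:(lra).
  have tS : sup S < t.
    by rewrite ltNge; apply/negP => le; have := fle _ _ le supy; lra.
  have : t <= sup S by apply: supub; split=> //; have := gdec _ _ tS ty; lra.
  by lra.
(* The maximum with [u] keeps the prescribed value above [y], where [fsurj] applies. *)
- pose w := Order.max u (f (sup S)).
  have uw : u <= w by rewrite le_max lexx.
  have fw : f (sup S) <= w by rewrite le_max lexx orbT.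
  have wg : w < g (sup S) by rewrite gt_max ug.
  have [t ty ft] := fsurj ((w + g (sup S)) / 2) ltac:(lra).
  have tS : t < sup S.
    by rewrite ltNge; apply/negP => le; have := fle _ _ le ty; lra.
  have : sup S <= t.
    apply: ge_sup; first by exists t1.
    move=> t' St'; rewrite leNgt; apply/negP => tt'.
    have [ty' gf'] := St'.
    by have := fdec _ _ tt' ty'; have := gle _ _ (supub _ St') supy; lra.
  by lra.
Qed.

Section Main.
Context {R : realType} (T : timed_causal_space R) (s : R) (hs : s ^+ 2 = 1) (x : S1 R).
Local Notation phi := (chart hs x).
Local Notation cyc := (cyc s).

Lemma cyc_chart_inf_mid t t' : cyc (phi t) x (phi t') -> t' < t.
Proof. by move=> /cyc_rot/cyc_chart_inf. Qed.

(** For a point [phi t] with [t < y], its partners with respect to [{x, phi y}] and to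
    [{phi u, phi v}] both decrease in [t]; a common perpendicular arises where they coincide. *)
Lemma common_perp (y u v : R) : y < u -> u < v ->
  exists t w, [/\ t < y, u < w, w < v,
    perp T x (phi y) (phi t) (phi w) & perp T (phi u) (phi v) (phi t) (phi w)].
Proof.
move=> yu uv.
have neq := @chart_neq _ _ hs x.
have cneq t t' : t < t' -> phi t <> phi t' /\ phi t' <> phi t.
  by move=> h; split=> /chart_inj e; lra.
(* [f] is the parameter of the partner with respect to [{x, phi y}]; for [t >= y] the witness is an
   irrelevant 0. *)
have /choice[f hf] : forall t, exists r,
    t < y -> y < r /\ perp T x (phi y) (phi t) (phi r).
  move=> t; case: (ltP t y) => ty; last by exists 0.
  have [l pl] := perp_ex T (nesym (neq y)) (neq t) (cneq _ _ ty).1.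
  have hl : cyc (phi y) l x by apply: perp_arc pl => //; cyc_chart_solve.
  have [_ lx _] := cyc_neq hl; have [r er] := chart_onto hs lx; subst.
  by move/cyc_rot/cyc_rot/cyc_chart_inf: hl => hl; exists r.
(* [g] does the same for [{phi u, phi v}], whose other arc confines its values to ]u, v[. *)
have /choice[g hg] : forall t, exists r,
    t < y -> [/\ u < r, r < v & perp T (phi u) (phi v) (phi t) (phi r)].
  move=> t; case: (ltP t y) => ty; last by exists 0.
  have [l pl] := perp_ex T (cneq _ _ uv).1 (cneq _ _ (lt_trans ty yu)).1
    (cneq _ _ (lt_trans ty (lt_trans yu uv))).1.
  have hl : cyc (phi u) l (phi v).
    by apply: perp_arc (perp_swapl pl) => //; cyc_chart_solve.
  have lx : l <> x by move=> e; subst; move/cyc_chart_inf_mid: hl; lra.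
  have [r er] := chart_onto hs lx; subst; exists r => _.
  by move/cyc_chart: hl => -[] [h1 h2]; split=> //; lra.
have [t ty e] : exists2 t, t < y & f t = g t.
  apply: (@decreasing_meet _ f g y u v) => //.
  - move=> t t' tt ty; have [h1 p1] := hf _ ty; have [h2 p2] := hf _ (lt_trans tt ty).
    have : cyc (phi y) (phi (f t')) (phi (f t)).
      by apply: perp_mono p2 p1 => //; cyc_chart_solve.
    by move/cyc_chart => -[] [? ?]; lra.
  - move=> t t' tt ty; have [h1 h2 p1] := hg _ ty.
    have [h3 h4 p2] := hg _ (lt_trans tt ty).
    have : cyc (phi u) (phi (g t')) (phi (g t)).
      by apply: perp_mono (perp_swapl p2) (perp_swapl p1) => //; cyc_chart_solve.
    by move/cyc_chart => -[] [? ?]; lra.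
  (* Taking partners is an involution, so the partner of [phi r] is the required preimage. *)
  - move=> r yr.
    have [l pl] := perp_ex T (nesym (neq y)) (neq r) (cneq _ _ yr).2.
    have hl : cyc x l (phi y).
      by apply: perp_arc (perp_swapl pl) => //; cyc_chart_solve.
    have [/nesym lx _ _] := cyc_neq hl; have [t et] := chart_onto hs lx; subst.
    move/cyc_chart_inf: hl => ty; exists t => //.
    have [_ p1] := hf _ ty.
    exact/(@chart_inj _ _ hs x)/(perp_uniq p1 (perp_swapr pl)).
  - by move=> t ty; case: (hg _ ty).
have [_ p1] := hf _ ty; have [h1 h2 p2] := hg _ ty.
by exists t, (f t); split; rewrite // e.
Qed.

Lemma time_lt_chart (z y u v : R) (a b c : event R) :
  z < y -> y < u -> u < v -> points a = [set x; phi z] ->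
  points b = [set x; phi y] -> points c = [set phi u; phi v] ->
  exists r t, [/\ time T b c = Some r, time T a c = Some t & r < t].
Proof.
move=> zy yu uv ha hb hc; rewrite setUC in hc.
have [P [P' [Py uP' P'v pb pc]]] := common_perp yu uv.
have [Q [Q' [Qz uQ' Q'v qa qc]]] := common_perp (lt_trans zy yu) uv.
have tb := time_perp (perp_sym pb) (perp_swapr (perp_sym pc)) hb hc.
have ta := time_perp (perp_sym qa) (perp_swapr (perp_sym qc)) ha hc.
do 2 eexists; split; [exact: tb|exact: ta|].
have e1 : line_time T x (phi v) (phi P) (phi P')
        = line_time T (phi P) (phi P') x (phi v).
  by apply: (line_time_dual T hs); cyc_chart_solve.
have e2 : line_time T x (phi v) (phi Q) (phi Q')
        = line_time T (phi Q) (phi Q') x (phi v).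
  by apply: (line_time_dual T hs); cyc_chart_solve.
rewrite -e1 -e2.
case: (ltgtP Q P) => QP.
- have : cyc (phi u) (phi P') (phi Q').
    by apply: perp_mono (perp_swapl qc) (perp_swapl pc) => //; cyc_chart_solve.
  move/cyc_chart => QP'; have {}QP' : P' < Q' by case: QP' => -[? ?]; lra.
  rewrite (line_time_add T hs (l := phi P) (r := phi Q')); try cyc_chart_solve.
  rewrite (line_time_add T hs (l := phi P') (r := phi Q')); try cyc_chart_solve.
  have : 0 < line_time T x (phi v) (phi Q) (phi P).
    by apply: (line_time_gt0 T hs); cyc_chart_solve.
  have : 0 < line_time T x (phi v) (phi P') (phi Q').
    by apply: (line_time_gt0 T hs); cyc_chart_solve.
  by lra.
- exfalso; have : cyc (phi u) (phi Q') (phi P').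
    by apply: perp_mono (perp_swapl pc) (perp_swapl qc) => //; cyc_chart_solve.
  move/cyc_chart => QP'; have {}QP' : Q' < P' by case: QP' => -[? ?]; lra.
  have g1 : line_time T x (phi v) (phi Q) (phi Q')
          < line_time T x (phi v) (phi P) (phi P').
    rewrite (line_time_add T hs (l := phi Q) (r := phi P')); try cyc_chart_solve.
    rewrite (line_time_add T hs (l := phi Q') (r := phi P')); try cyc_chart_solve.
    have : 0 < line_time T x (phi v) (phi P) (phi Q).
      by apply: (line_time_gt0 T hs); cyc_chart_solve.
    have : 0 < line_time T x (phi v) (phi Q') (phi P').
      by apply: (line_time_gt0 T hs); cyc_chart_solve.
    by lra.
  (* Going from [phi u] to [phi z] through [x], one meets Q', P', P, Q in this order. The arguments
     follow that order for [line_time_add], and [e3] then restores the other one. *)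
  have g2 : line_time T (phi u) (phi z) (phi P') (phi P)
          < line_time T (phi u) (phi z) (phi Q') (phi Q).
    rewrite (line_time_add T hs (k := phi Q') (l := phi P')); try cyc_chart_solve.
    rewrite (line_time_add T hs (k := phi P') (l := phi P) (r := phi Q));
      try cyc_chart_solve.
    have : 0 < line_time T (phi u) (phi z) (phi P) (phi Q).
      by apply: (line_time_gt0 T hs); cyc_chart_solve.
    have : 0 < line_time T (phi u) (phi z) (phi Q') (phi P').
      by apply: (line_time_gt0 T hs); cyc_chart_solve.
    by lra.
  have e3 t t' : t < z -> u < t' -> line_time T (phi u) (phi z) (phi t') (phi t)
      = line_time T (phi t) (phi t') (phi z) (phi u).
    move=> tz ut; rewrite line_time_swapl line_time_swapr; symmetry.
    by apply: (line_time_dual T hs); cyc_chart_solve.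
  rewrite !e3 // in g2; last by lra.
  have e4 := line_time_perp (perp_sym qa) (perp_swapr (perp_sym qc)).
  have e5 := line_time_perp (perp_sym pb) (perp_swapr (perp_sym pc)).
  have e6 : line_time T (phi P) (phi P') (phi z) (phi u)
     = line_time T (phi P) (phi P') (phi z) (phi y)
     + line_time T (phi P) (phi P') (phi y) (phi u).
    by apply: (line_time_add T hs); cyc_chart_solve.
  have : 0 < line_time T (phi P) (phi P') (phi z) (phi y).
    by apply: (line_time_gt0 T hs); cyc_chart_solve.
  by lra.
- exfalso; subst Q; have e := perp_uniq pc qc.
  rewrite -e in qa.
  by have /(@chart_inj _ _ hs x) := perp_uniq (perp_sym pb) (perp_sym qa); lra.
Qed.

End Main.

(** * From closed arcs to the cyclic order, and the cases of the inequality *)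

Section Arcs.
Context {R : realType}.
Implicit Types (k l x y z u v : S1 R) (a b c : event R).

(** Were [u] on the same side of [b] as [z], both points would lie in one component and the two
    closed arcs would be equal. *)
Lemma arcs_of_cyc s b Am Ap x y z u : s ^+ 2 = 1 -> points b = [set x; y] ->
  arcs_of b Am Ap -> Am z -> Ap u -> ~ points b z -> ~ points b u ->
  cyc s x z y -> cyc s y u x.
Proof.
move=> hs hb [[w [_ ->]] [w' [_ ->]] neq] [//|/same_connected_component ez].
case=> [//|/same_connected_component eu] bz bu hz.
have [xu yu] : x <> u /\ u <> y by rewrite hb in bu; split=> e; apply: bu; [left|right].
have [_ _ xy] := cyc_neq hz.
case: (cyc_total hs xu yu xy) => hu; last exact: cyc_rot.
case: neq; rewrite ez eu; congr (_ `|` _); apply: same_connected_component.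
by rewrite hb; apply: component_same_arc hz hu.
Qed.

(** Choosing the orientation to fit three given points removes the mirror-image cases; this is the
    purpose of the parameter [s]. *)
Lemma sign_cyc x y z : x <> z -> z <> y -> x <> y ->
  exists2 s : R, s ^+ 2 = 1 & cyc s x z y.
Proof.
move=> xz zy xy; have h1 : (1 : R) ^+ 2 = 1 by rewrite expr1n.
case: (cyc_total h1 xz zy xy) => h; first by exists 1.
exists (-1); first by rewrite sqrrN expr1n.
move: h; rewrite /cyc mulN1r mul1r.
by congr (0 < _); rewrite /det; ring.
Qed.

Lemma common_light_lineP a b :
  on_common_light_line a b <-> exists x, points a x /\ points b x.
Proof.
split=> [[x [[y [_ e]] [y' [_ e']]]]|[x [ax bx]]].
  by exists x; rewrite e e'; split; left.
have [y e] := event_other ax; have [y' e'] := event_other bx.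
by exists x; split; [exists y|exists y']; split=> //; apply/nesym/(event_neq (a := _));
  eassumption.
Qed.

Lemma on_common_light_lineC a b : on_common_light_line a b -> on_common_light_line b a.
Proof. by case=> x [? ?]; exists x. Qed.

Lemma event_le_sym a b c : event_le a b c -> event_le c b a.
Proof. by move=> [A [B [[? ? ?] ? ?]]]; exists B, A; split=> //; split=> //; apply/nesym. Qed.

End Arcs.

(** Here t(a, b) = 0 by (t2). The chart at the shared point, oriented so that Z < Y, places [c]
    beyond Y, and [time_lt_chart] compares the other two times. *)
Lemma weak_time_inequality_left (R : realType) (T : timed_causal_space R) (a b c : event R) :
  event_le a b c -> a <> b -> on_common_light_line b a ->
  ~ on_common_light_line b c ->
  exists r s u : R, [/\ time T a b = Some r, time T b c = Some s, time T a c = Some u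
      & r + s < u].
Proof.
move=> [Am [Ap [harcs ham hcp]]] ab /common_light_lineP[x [bx ax]] nbc.
have nc w : points b w -> ~ points c w.
  by move=> bw cw; apply: nbc; apply/common_light_lineP; exists w.
have [y hb] := event_other bx; have [z ha] := event_other ax.
have xy := event_neq hb; have xz := event_neq ha.
have zy : z <> y by move=> e; apply: ab; apply: event_eq; rewrite ha hb e.
have [s hs hz] := sign_cyc xz zy xy.
have bz : ~ points b z by rewrite hb => -[/nesym|].
have az : Am z by apply: ham; rewrite ha; right.
have [u [v [uv hc]]] := pointsP c.
(* Since [c] is disjoint from [b], its end points lie in the open arc opposite to [z]. *)
have side w : points c w -> cyc s y w x.
  move=> cw; apply: (arcs_of_cyc hs hb harcs az (hcp _ cw) bz _ hz).
  by move=> /nc; apply.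
have tab : time T a b = Some 0 by apply/tcs_t2/common_light_lineP; exists x.
have [Z eZ] := chart_onto hs (nesym xz); have [Y eY] := chart_onto hs (nesym xy).
have hu : cyc s y u x by apply: side; rewrite hc; left.
have hv : cyc s y v x by apply: side; rewrite hc; right.
have [_ ux _] := cyc_neq hu; have [_ vx _] := cyc_neq hv.
have [U eU] := chart_onto hs ux; have [V eV] := chart_onto hs vx.
subst; move/cyc_chart_inf: hz => ZY.
move/cyc_rot/cyc_rot/cyc_chart_inf: hu => YU.
move/cyc_rot/cyc_rot/cyc_chart_inf: hv => YV.
have [r [t [tb ta rt]]] : exists r t,
    [/\ time T b c = Some r, time T a c = Some t & r < t].
  case: (ltgtP U V) => UV.
  - exact: (time_lt_chart T ZY YU UV ha hb hc).
  - by rewrite setUC in hc; exact: (time_lt_chart T ZY YV UV ha hb hc).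
  - by case: uv; rewrite UV.
by exists 0, r, t; rewrite add0r.
Qed.

(** For the case where [b] meets both [a] and [c]: it makes t(a, c) defined. The cyclic order is x,
    z, y, w, so [{x, z}] and [{y, w}] do not cross. *)
Lemma event_le_causal (R : realType) (a b c : event R) (x y z w : S1 R) :
  points a = [set x; z] -> points b = [set x; y] -> points c = [set y; w] ->
  event_le a b c -> a <> b -> c <> b -> causal a c.
Proof.
move=> ha hb hc [Am [Ap [harcs ham hcp]]] ab cb.
have [xz xy yw] := And3 (event_neq ha) (event_neq hb) (event_neq hc).
have zy : z <> y by move=> e; apply: ab; apply: event_eq; rewrite ha hb e.
have wx : w <> x by move=> e; apply: cb; apply: event_eq; rewrite hc hb e setUC.
have [s hs hz] := sign_cyc xz zy xy.
have hw : cyc s y w x.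
  apply: (arcs_of_cyc hs hb harcs _ _ _ _ hz (z := z)).
  - by apply: ham; rewrite ha; right.
  - by apply: hcp; rewrite hc; right.
  - by rewrite hb => -[/nesym|].
  - by rewrite hb => -[|/nesym].
have hyzx : cyc s y x z by apply/cyc_rot/cyc_rot.
move=> /(separatesP hs ha hc)[[h _]|[h _]].
  exact: cyc_asym hw h.
have hyw := cyc_trans hs hw hyzx.
exact: cyc_asym hyw h.
Qed.

Theorem theorem7p3 (R : realType) (T : timed_causal_space R) (a b c : event R) :
  event_lt a b c ->
  on_common_light_line b a \/ on_common_light_line b c ->
  ~ on_common_light_line a c ->
  exists r s u : R,
    [/\ time T a b = Some r, time T b c = Some s, time T a c = Some u
      & (r + s < u)%R].
Proof.
move=> [hle ab cb] hl nac.
(* If [b] meets only [c], the roles of [a] and [c] are exchanged. If it meets both, the two times on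
   the left vanish and only t(a, c) > 0 remains. *)
have [hba|nba] := pselect (on_common_light_line b a); last first.
  have hbc : on_common_light_line b c by case: hl.
  have [r [t [u [h1 h2 h3 h4]]]] :=
    weak_time_inequality_left T (event_le_sym hle) cb hbc nba.
  (* The causality required by (t3) follows from the time being defined, by (t1). *)
  have swap e e' q : time T e e' = Some q -> time T e' e = Some q.
    by move=> E; rewrite -tcs_t3 //; apply/(tcs_t1 T).1; rewrite E.
  by exists t, r, u; rewrite addrC; split=> //; apply: swap.
have [hbc|nbc] := pselect (on_common_light_line b c); last first.
  exact: weak_time_inequality_left.
have tab : time T a b = Some 0 by apply/tcs_t2/on_common_light_lineC.
have tbc : time T b c = Some 0 by apply/tcs_t2.
move/common_light_lineP: hba => [x [bx ax]].
move/common_light_lineP: hbc => [y [by_ cy]].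
have xy : x <> y by move=> e; subst; apply: nac; apply/common_light_lineP; exists y.
have [y' hb] := event_other bx.
have ? : y = y' by move: by_; rewrite hb => -[/nesym|].
subst y'; have [z ha] := event_other ax; have [w hc] := event_other cy.
have hac := event_le_causal ha hb hc hle ab cb.
have : time T a c by apply/(tcs_t1 T).1.
case E: (time T a c) => [u|//] _; exists 0, 0, u; split=> //.
have u_ge0 := (tcs_t1 T).2 _ _ _ E; rewrite addr0 lt0r u_ge0 andbT.
by apply/eqP => u0; apply: nac; apply/(tcs_t2 T); rewrite E u0.
Qed.
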